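(* Let $C>0$. There exist constants $C_0>0$ and $n_0\geq 1$, depending only on $C$, such that for every $n\geq n_0$, every $C$-balanced partition $\lambda\vdash n$ and every permutation $\sigma\in\mathfrak{S}_n\setminus\{\mathrm{Id}\}$, $$|\chi^\lambda(\sigma)|\leq \left(\frac{C_0}{\sqrt{|\sigma|}}\right)^{|\sigma|}.$$
   Context: $\mathfrak{S}_n$ is the symmetric group on $n$ elements. Irreducible complex representations of $\mathfrak{S}_n$ are indexed in the usual way by partitions $\lambda\vdash n$ (with $[n]$ corresponding to the trivial representation); $d_\lambda$ is the dimension and $\mathrm{ch}^\lambda$ the character of the representation $\lambda$, and $\chi^\lambda(\sigma):=\mathrm{ch}^\lambda(\sigma)/d_\lambda$ is the normalized character. For $\sigma\in\mathfrak{S}_n$, $|\sigma|$ is the minimal number of transpositions whose product is $\sigma$. For a partition $\lambda$, $\lambda_1$ is the length of its first row, $\lambda_1'$ the length of its first column, and $s(\lambda):=\lambda_1+\lambda_1'-1$ is its maximal hook length. For $C>0$, a partition $\lambda\vdash n$ is called $C$-balanced if $s(\lambda)\leq C\sqrt{n}$. *)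

(* Defs.v *)
From HB Require Import structures.
From mathcomp Require Import all_boot all_order all_fingroup all_algebra.
From mathcomp Require Import mxrepresentation.
From mathcomp Require Import reals complex.

Set Implicit Arguments.
Unset Strict Implicit.
Unset Printing Implicit Defensive.

Import GroupScope Order.TTheory GRing.Theory Num.Theory.
Local Open Scope nat_scope.
Local Open Scope ring_scope.

Definition is_partition (n : nat) (la : seq nat) : bool :=
  [&& sorted geq la, 0%N \notin la & sumn la == n].

(* la_1 + la_1' - 1; the truncated predecessor only matters for n = 0. *)
Definition max_hook (la : seq nat) : nat := (head 0%N la + size la).-1.

Definition balanced (R : realType) (C : R) (n : nat) (la : seq nat) : Prop :=
  (max_hook la)%:R <= C * Num.sqrt n%:R.

Section SpechtModule.

(* The boxes of the Young diagram of la |- n are numbered by 'I_n, row after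
   row: box k is in row [reshape_index la k] and column [reshape_offset la k]. *)
Variables (n : nat) (la : seq nat).

Definition row_stab : {set 'S_n} :=
  [set s : 'S_n | [forall k, reshape_index la (s k) == reshape_index la k]].

Definition col_stab : {set 'S_n} :=
  [set s : 'S_n | [forall k, reshape_offset la (s k) == reshape_offset la k]].

Variable F : fieldType.

Let regS := regular_repr F [set: 'S_n].

(* The Young symmetrizer \sum_(p, q) sgn(q) p q, as a vector of the group
   algebra F['S_n]. *)
Definition young_symmetrizer : 'rV[F]_#|[set: 'S_n]| :=
  gring_row (\sum_(p in row_stab) \sum_(q in col_stab)
               (-1) ^+ q *: regS (p * q)%g).

(* MathComp representations act on the right on row vectors, so the irreducible
   representation indexed by la is here the right ideal generated by the Young
   symmetrizer. It is dual to the corresponding left ideal, so, representations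
   of 'S_n being self-dual, it has the same character. *)
Definition specht_mx : 'M[F]_#|[set: 'S_n]| := cyclic_mx regS young_symmetrizer.

Definition specht_repr : mx_representation F [set: 'S_n] (\rank specht_mx) :=
  submod_repr (cyclic_mx_module regS young_symmetrizer).

Definition specht_dim : nat := \rank specht_mx.

Definition specht_char (s : 'S_n) : F := \tr (specht_repr s).

Definition specht_nchar (s : 'S_n) : F := specht_char s / specht_dim%:R.

End SpechtModule.

Section TranspositionLength.

Variables (n : nat) (s : 'S_n).

Definition is_tperm_prod (k : nat) : bool :=
  [exists ts : k.-tuple ('I_n * 'I_n),
     all dpair ts && (s == (\prod_(t <- ts) tperm t.1 t.2)%g)].

Lemma ex_tperm_prod : exists k, is_tperm_prod k.
Proof.
have [ts def_s ts_dpair] := prod_tpermP s.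
exists (size ts); apply/existsP; exists (in_tuple ts).
by rewrite ts_dpair def_s eqxx.
Qed.

Definition tperm_length : nat := ex_minn ex_tperm_prod.

End TranspositionLength.

(* Main.v *)
(* Let V be the representation indexed by la, n = |la|, and let the diagram lie
   in an M x M square with M <= C sqrt n. The Young symmetrizer gives the
   normalized character chi as a signed count of fillings of the diagram, from
   which chi is seen to be positive definite. The heart of the proof is, for
   every D of size k and S_D the group of permutations supported on D,
     n (n - 1) ... (n - k + 1) * \sum_(h in S_D) chi(h)^2 <= M^(2k).
   Indeed, grouping the fillings by their restrictions to D, the left-hand side
   is a sum of nonnegative terms indexed by some maps from D to the boxes of the
   diagram; extending it to all maps from D to the square bounds it by chi(Z),
   where Z = Z^- Z^+ and Z^+, Z^- are the sums over h in S_D of M^(cycles h) h,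
   without and with signs. In terms of the Jucys-Murphy elements X_j,
   Z = \prod_j (M + X_j) (M - X_j), so Z is nonnegative and adding one point to D
   multiplies chi(Z) by at most M^2.
   Taking for D the set of points moved by s, the sum is at least chi(s)^2 times
   the size k! / |C(s)| of the class of s in S_D, and |C(s)| <= k^(k - |s|) since
   s has at most k - |s| cycles in D and the centralizer is determined by its
   values at one point per cycle. As k <= 2 |s| and k^k n^k (n - k)! <=
   16^k k! n!, the theorem follows. *)

From HB Require Import structures.
Require Import Defs.
From mathcomp Require Import all_boot all_order all_fingroup all_algebra.
From mathcomp Require Import mxrepresentation zify.
From mathcomp Require Import reals complex.

Import GroupScope Order.TTheory GRing.Theory Num.Theory.
Local Open Scope nat_scope.
Local Open Scope ring_scope.
Local Open Scope complex_scope.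

Set Implicit Arguments.
Unset Strict Implicit.
Unset Printing Implicit Defensive.

(** * The group algebra of a finite group *)

Section RegularMatrix.

Variables (R : fieldType) (gT : finGroupType).
Local Notation G := [set: gT]%G.
Local Notation aG := (regular_repr R G).

Lemma regular_mxM (x y : gT) : aG (x * y)%g = aG x *m aG y.
Proof. by rewrite repr_mxM ?inE. Qed.

Lemma regular_mxE (x g h : gT) :
  aG x (gring_index G g) (gring_index G h) = (h == g * x)%g%:R.
Proof.
rewrite !mxE /= gring_indexK ?inE //.
by rewrite (inj_in_eq (can_in_inj (@gring_indexK _ G))) ?inE.
Qed.

(** Permutation matrices are orthogonal. Transposition thus serves as the involution of the group
    algebra that inverts group elements. *)
Lemma regular_mxV (x : gT) : aG x^-1%g = (aG x)^T.
Proof.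
apply/matrixP=> k l.
rewrite -[k](gring_valK (G := G)) -[l](gring_valK (G := G)) [RHS]mxE.
by rewrite !regular_mxE eq_sym (can2_eq (mulgKV _) (mulgK _)).
Qed.

End RegularMatrix.

Section GroupAlgebra.

Variables (R : realFieldType) (gT : finGroupType).
Local Notation G := [set: gT]%G.
Local Notation aG := (regular_repr R G).
Local Notation R_G := (group_ring R G).

Variable chi : gT -> R.

(* Row [1] of a matrix in the group algebra lists its coefficients. *)
Definition gtau (A : 'M[R]_#|G|) : R :=
  \sum_g chi g * A (gring_index G 1%g) (gring_index G g).

Lemma gtau_is_scalar : scalar gtau.
Proof.
move=> a A B; rewrite /gtau mulr_sumr -big_split /=.
by apply: eq_bigr => g _; rewrite !mxE mulrDr mulrCA.
Qed.

HB.instance Definition _ :=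
  GRing.isLinear.Build R 'M[R]_#|G| R *%R gtau gtau_is_scalar.

Lemma gtauZ a (A : 'M[R]_#|G|) : gtau (a *: A) = a * gtau A.
Proof. exact: linearZ. Qed.

Lemma gtauG (x : gT) : gtau (aG x) = chi x.
Proof.
rewrite /gtau (bigD1 x) //= big1 ?addr0 => [|g neq_gx].
  by rewrite regular_mxE mul1g eqxx mulr1.
by rewrite regular_mxE mul1g (negPf neq_gx) mulr0.
Qed.

Hypothesis chi_class : forall x y : gT, chi (x * y)%g = chi (y * x)%g.

Lemma gtauC (A B : 'M[R]_#|G|) : (A \in R_G)%MS -> (B \in R_G)%MS ->
  gtau (A *m B) = gtau (B *m A).
Proof.
move=> /envelop_mxP[a ->] /envelop_mxP[b ->].
rewrite !mulmx_suml !linear_sum /=; under eq_bigr do rewrite mulmx_sumr linear_sum.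
under [RHS]eq_bigr do rewrite mulmx_sumr linear_sum.
rewrite exchange_big; apply: eq_bigr => x _; apply: eq_bigr => y _.
rewrite -!scalemxAl -!scalemxAr !linearZ /= -!regular_mxM !gtauG chi_class.
by rewrite !mulrA [a y * _]mulrC.
Qed.

Hypothesis chi_psd : forall y : gT -> R,
  0 <= \sum_u \sum_v y u * y v * chi (u^-1 * v)%g.

(** Since transposition inverts group elements, the value is the quadratic form of [chi_psd] at the
    coefficients of [A]. *)
Lemma gtau_psd (A : 'M[R]_#|G|) : (A \in R_G)%MS -> 0 <= gtau (A^T *m A).
Proof.
move=> /envelop_mxP[a ->].
rewrite [(\sum_(_ in _) _)^T]linear_sum mulmx_suml linear_sum /=.
rewrite (_ : \sum_(i in _) _ = \sum_u \sum_v a u * a v * chi (u^-1 * v)%g) //.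
apply: eq_big => [x|x _]; first by rewrite inE.
rewrite mulmx_sumr linear_sum; apply: eq_big => [y|y _]; first by rewrite inE.
rewrite [(_ *: _)^T]linearZ -scalemxAl -scalemxAr !linearZ /=.
by rewrite -regular_mxV -regular_mxM gtauG mulrA.
Qed.

End GroupAlgebra.

(** * Symmetrizers and Jucys-Murphy elements *)

Section Fixing.

Variables (T : finType) (A : eqType).
Implicit Types (a : T -> A) (s g : {perm T}).

Definition fixing a : {set {perm T}} :=
  [set s : {perm T} | [forall x, a (s x) == a x]].

Lemma fixingP a s : reflect (forall x, a (s x) = a x) (s \in fixing a).
Proof. by rewrite inE; apply: (iffP forallP) => as_a x; apply/eqP. Qed.

Lemma fixing_group_set a : group_set (fixing a).
Proof.
apply/group_setP; split=> [|s t /fixingP fix_s /fixingP fix_t].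
  by apply/fixingP=> x; rewrite perm1.
by apply/fixingP=> x; rewrite permM fix_t fix_s.
Qed.
Canonical fixing_group a := Group (fixing_group_set a).

Lemma fixingJ a s g : (s ^ g \in fixing (a \o g^-1))%g = (s \in fixing a).
Proof.
apply/fixingP/fixingP=> fix_s x /=.
  by have:= fix_s (g x); rewrite /= permJ !permK.
by rewrite -{1}[x](permKV g) permJ permK fix_s.
Qed.

End Fixing.

Section Symmetrizer.

Variables (R : fieldType) (T : finType).
Local Notation G := [set: {perm T}]%G.
Local Notation aG := (regular_repr R G).
Local Notation R_G := (group_ring R G).
Implicit Types (e : bool) (D : {set T}) (K L : {group {perm T}}).

(** The boolean selects the sign character ([true]) or the trivial one ([false]), so that
    symmetrizers and antisymmetrizers are treated together. *)
Definition sgn e (s : {perm T}) : R := (-1) ^+ (e && s).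

Lemma sgnM e (s t : {perm T}) : sgn e (s * t)%g = sgn e s * sgn e t.
Proof. by case: e; rewrite /sgn /= ?expr0 ?mulr1 // odd_permM signr_addb. Qed.

Lemma sgnV e (s : {perm T}) : sgn e s^-1%g = sgn e s.
Proof. by rewrite /sgn odd_permV. Qed.

Definition symmetrizer e (K : {set {perm T}}) : 'M[R]_#|G| :=
  \sum_(k in K) sgn e k *: aG k.

Lemma symmetrizer_in e K : (symmetrizer e K \in R_G)%MS.
Proof.
by rewrite linear_sum summx_sub // => k _; rewrite linearZ scalemx_sub
   ?envelop_mx_id ?inE.
Qed.

Lemma tr_symmetrizer e K : (symmetrizer e K)^T = symmetrizer e K.
Proof.
rewrite /symmetrizer linear_sum /= (reindex_inj invg_inj) /=.
by apply: eq_big => [k|k _]; rewrite ?groupV // linearZ /= -regular_mxV invgK sgnV.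
Qed.

Lemma symmetrizerMl e K k : k \in K ->
  aG k *m symmetrizer e K = sgn e k *: symmetrizer e K.
Proof.
move=> Kk; rewrite /symmetrizer mulmx_sumr scaler_sumr.
rewrite [RHS](reindex_inj (mulgI k)) /=.
apply: eq_big => [l|l _]; first by rewrite groupMl.
rewrite -scalemxAr -regular_mxM scalerA sgnM mulrA; congr (_ *: _).
by rewrite /sgn -signr_addb addbb mul1r.
Qed.

Lemma symmetrizerMr e K k : k \in K ->
  symmetrizer e K *m aG k = sgn e k *: symmetrizer e K.
Proof.
move=> Kk; apply: (can_inj trmxK); rewrite trmx_mul -regular_mxV linearZ /=.
by rewrite tr_symmetrizer symmetrizerMl ?groupV // sgnV.
Qed.

Lemma symmetrizer_sq e K :
  symmetrizer e K *m symmetrizer e K = #|K|%:R *: symmetrizer e K.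
Proof.
rewrite {1}/symmetrizer mulmx_suml.
rewrite (eq_bigr (fun=> symmetrizer e K)); first by rewrite sumr_const scaler_nat.
move=> k Kk; rewrite -scalemxAl symmetrizerMl // scalerA.
by rewrite /sgn -signr_addb addbb scale1r.
Qed.

Lemma symmetrizerJ e (K : {set {perm T}}) (g : {perm T}) :
  symmetrizer e (K :^ g)%g *m aG g^-1%g = aG g^-1%g *m symmetrizer e K.
Proof.
rewrite /symmetrizer (reindex_inj (conjg_inj g)) mulmx_suml mulmx_sumr /=.
apply: eq_big => [k|k _]; first by rewrite memJ_conjg.
rewrite -scalemxAl -scalemxAr -!regular_mxM conjgE -!mulgA mulgV mulg1 !sgnM.
by rewrite mulrCA sgnV /sgn -signr_addb addbb mulr1.
Qed.

End Symmetrizer.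

Section JucysMurphy.

Variables (R : realFieldType) (T : finType) (m : nat).
Local Notation G := [set: {perm T}]%G.
Local Notation aG := (regular_repr R G).
Local Notation R_G := (group_ring R G).
Local Notation sgn := (sgn R).
Local Notation symmetrizer := (symmetrizer R).
Implicit Types (e : bool) (D : {set T}) (K L : {group {perm T}}).
Local Notation M := m.+1.
Implicit Type a : {ffun T -> 'I_M}.

(** Pinning the color to [ord0] outside [D] makes each map from [D] to the colors count exactly
    once. *)
Definition colorings D : {set {ffun T -> 'I_M}} :=
  [set a : {ffun T -> 'I_M} | [forall x, (x \notin D) ==> (a x == ord0)]].

Lemma coloringsP D a :
  reflect (forall x, x \notin D -> a x = ord0) (a \in colorings D).
Proof.
rewrite inE; apply: (iffP forallP) => a0 x; first by move/(implyP (a0 x))/eqP.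
by apply/implyP=> Dx; rewrite a0.
Qed.

(* The coefficient of [v] is, up to sign, [M] to the number of cycles of [v] in
   [D], seen as the number of colorings of [D] constant on these cycles. *)
Definition Zmx e D := \sum_(a in colorings D) symmetrizer e (Sym D :&: fixing a).

Definition ncol D (v : {perm T}) := #|[set a in colorings D | v \in fixing a]|.

Lemma ZmxE e D :
  Zmx e D = \sum_(v in Sym D) (sgn e v * (ncol D v)%:R) *: aG v.
Proof.
rewrite /Zmx (exchange_big_dep [in Sym D]) /=; last by move=> a v _ /setIP[].
apply: eq_bigr => v Dv; rewrite sumr_const -scaler_nat scalerA mulrC.
congr ((_ * _%:R) *: _); apply: eq_card => a.
by rewrite [in RHS]inE -!topredE /= in_setI Dv.
Qed.

(** Conjugation by [g] carries the stabilizer of a coloring to that of the translated coloring,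
    hence only permutes the summands of [Zmx e D]. *)
Lemma Zmx_comm e D (g : {perm T}) : g \in Sym D ->
  aG g *m Zmx e D = Zmx e D *m aG g.
Proof.
rewrite -[g]invgK; move: g^-1%g => {}g; rewrite groupV => Dg.
rewrite /Zmx mulmx_suml mulmx_sumr.
pose act (h : {perm T}) a := [ffun x => a (h x)].
have actK h : cancel (act h) (act h^-1%g).
  by move=> a; apply/ffunP=> x; rewrite !ffunE permKV.
have actKV h : cancel (act h^-1%g) (act h).
  by move=> a; apply/ffunP=> x; rewrite !ffunE permK.
rewrite [RHS](reindex (act g^-1%g)) /=; last first.
  by exists (act g) => a _; [apply: actKV | apply: actK].
apply: eq_big => [a|a _]; last first.
  rewrite -symmetrizerJ; congr (symmetrizer e _ *m _).
  apply/setP=> s; rewrite conjIg (conjGid Dg) !in_setI; congr (_ && _).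
  rewrite mem_conjg -(fixingJ a _ g) -conjgM mulVg conjg1.
  by apply/fixingP/fixingP=> fix_s x; have:= fix_s x; rewrite /act /= !ffunE.
move: Dg; rewrite inE => /[dup] /perm_onV Dg' Dg.
apply/coloringsP/coloringsP => a0 x Dx.
  by rewrite /act ffunE a0 ?perm_closed.
by have:= a0 (g x); rewrite /act ffunE permK; apply; rewrite perm_closed.
Qed.

Section Step.

Variables (D : {set T}) (j : T).
Hypothesis Dj : j \notin D.

Definition extend a (c : 'I_M) : {ffun T -> 'I_M} :=
  [ffun x => if x == j then c else a x].

Lemma extend_colorings a c : a \in colorings D -> extend a c \in colorings (j |: D).
Proof.
move/coloringsP=> a0; apply/coloringsP=> x; rewrite !inE negb_or ffunE.
by case/andP=> /negPf-> /a0.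
Qed.

Lemma extend_inj : {in [set p | p.1 \in colorings D] &,
  injective (fun p : {ffun T -> 'I_M} * 'I_M => extend p.1 p.2)}.
Proof.
move=> [a c] [b d]; rewrite in_set => /coloringsP a0.
rewrite in_set => /coloringsP b0 /ffunP eq_ab.
congr (_, _); last by have:= eq_ab j; rewrite !ffunE eqxx.
apply/ffunP=> x; have:= eq_ab x; rewrite !ffunE.
by case: eqP => // -> _; rewrite a0 ?b0.
Qed.

Lemma extend_onto a : a \in colorings (j |: D) ->
  exists2 b, b \in colorings D & a = extend b (a j).
Proof.
move/coloringsP=> a0; exists [ffun x => if x == j then ord0 else a x].
  apply/coloringsP=> x Dx; rewrite ffunE; case: eqP => // /eqP neq_xj.
  by rewrite a0 // !inE negb_or neq_xj.
by apply/ffunP=> x; rewrite !ffunE; case: eqP => // ->.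
Qed.

(** Right multiplication by [tperm k j] inserts [j] into the cycle of [k], which forces its color,
    unless [k = j], when [j] is a new cycle whose color is free. *)
Lemma extend_fixing a c (v : {perm T}) (k : T) :
    a \in colorings D -> v \in Sym D -> k \in j |: D ->
  (v * tperm k j \in fixing (extend a c))%g =
    (v \in fixing a) && ((k == j) || (c == a k)).
Proof.
move=> Da; rewrite [v \in Sym D]inE => Dv Dk.
have vj: v j = j by apply: out_perm Dv Dj.
have fix_v: (v \in fixing (extend a c)) = (v \in fixing a).
  apply/fixingP/fixingP=> fix_v x; have:= fix_v x; rewrite ?ffunE.
    case: (x =P j) => [->|/eqP neq_xj]; first by rewrite vj.
    by rewrite -[X in v x == X]vj (inj_eq perm_inj) (negPf neq_xj).
  by rewrite -[X in v x == X]vj (inj_eq perm_inj); case: eqP.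
have [eq_kj | neq_kj] /= := eqVneq k j.
  by rewrite eq_kj tperm1 mulg1 fix_v andbT.
have [eq_c | neq_c] /= := eqVneq c (a k).
  rewrite andbT -fix_v groupMr //; apply/fixingP=> x; rewrite !ffunE.
  case: tpermP => [-> | -> | _ _] //.
    by rewrite eqxx (negPf neq_kj).
  by rewrite eqxx (negPf neq_kj).
rewrite andbF; apply/fixingP=> /(_ j); rewrite permM vj tpermR !ffunE eqxx.
by rewrite (negPf neq_kj) => /esym/eqP; rewrite (negPf neq_c).
Qed.

Lemma ncol_step (v : {perm T}) (k : T) : v \in Sym D -> k \in j |: D ->
  (ncol (j |: D) (v * tperm k j)%g = (if k == j then M else 1) * ncol D v)%N.
Proof.
move=> Dv Dk; pose ext (p : {ffun T -> 'I_M} * 'I_M) := extend p.1 p.2.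
pose W := [set a in colorings D | v \in fixing a].
pose V := [set p | (p.1 \in W) && ((k == j) || (p.2 == p.1 k))].
have ->: ncol (j |: D) (v * tperm k j)%g = #|ext @: V|.
  congr #|pred_of_set _|; apply/setP=> a; apply/idP/imsetP => [|[[b c]]].
    rewrite in_set => /andP[/extend_onto[b Db def_a]].
    rewrite {1}def_a extend_fixing // => Vb; exists (b, a j) => //.
    by rewrite in_set /= in_set Db.
  case/setIdP=> /setIdP[/= Db fix_b] /= kc ->.
  by rewrite in_set extend_colorings // extend_fixing // fix_b.
rewrite card_in_imset; last first.
  apply: sub_in2 extend_inj => p; rewrite [in X in _ -> X]in_set.
  by case/setIdP=> /setIdP[].
have [eq_kj | neq_kj] := eqVneq k j.
  rewrite mulnC -[in RHS](card_ord M) -[#|'I_M|]cardsT -cardsX.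
  by apply: eq_card => -[a c]; rewrite in_setX in_setT [in LHS]in_set /= eq_kj eqxx.
rewrite mul1n -[ncol D v]/#|W|.
rewrite -(card_in_imset (f := fun a => (a, a k)) (D := W)) => [|a b _ _ []] //.
apply: eq_card => -[a c]; rewrite inE (negPf neq_kj) /=.
apply/andP/imsetP => [[Wa /eqP->] | [b Wb [-> ->]]]; first by exists a.
by rewrite eqxx.
Qed.

(** Coset decomposition: if [g] sends [j] to [k], then [g * tperm k j] fixes [j] and so lies in
    [Sym D]. *)
Lemma sum_Sym_step (V : nmodType) (F : {perm T} -> V) :
  \sum_(g in Sym (j |: D)) F g
    = \sum_(k in j |: D) \sum_(v in Sym D) F (v * tperm k j)%g.
Proof.
rewrite (partition_big (fun g : {perm T} => g j) [in j |: D]) /=; last first.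
  by move=> g; rewrite inE => Dg; rewrite perm_closed ?setU11.
apply: eq_bigr => k Dk.
rewrite (reindex_inj (can_inj (mulgK (tperm k j)))) /=.
apply: eq_bigl => v; rewrite !inE permM.
rewrite (can2_eq (tpermK _ _) (tpermK _ _)) tpermL.
have Dt: perm_on (j |: D) (tperm k j).
  apply/subsetP=> x; rewrite inE; apply: contraR => Dx; apply/eqP.
  by rewrite tpermD //; apply: contraNneq Dx => <- //; rewrite setU11.
have := groupMr v (_ : tperm k j \in Sym (j |: D)); rewrite !inE => -> //.
apply/andP/idP => [[/subsetP Dv /eqP vj] | Dv]; last first.
  rewrite (out_perm Dv Dj); split=> //; apply: subset_trans Dv _.
  exact: subsetUr.
apply/subsetP=> x vx; have := Dv x vx; rewrite !inE => /predU1P[eq_xj|//].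
by move: vx; rewrite inE eq_xj vj eqxx.
Qed.

Definition murphy : 'M[R]_#|G| := \sum_(k in D) aG (tperm k j).

Lemma murphy_in : (murphy \in R_G)%MS.
Proof. by rewrite linear_sum summx_sub // => k _; rewrite envelop_mx_id ?inE. Qed.

Lemma tr_murphy : murphy^T = murphy.
Proof.
by rewrite /murphy linear_sum /=; apply: eq_bigr => k _; rewrite -regular_mxV tpermV.
Qed.

Lemma murphy_comm (g : {perm T}) : g \in Sym D -> aG g *m murphy = murphy *m aG g.
Proof.
rewrite inE => Dg; rewrite /murphy mulmx_suml mulmx_sumr.
rewrite [RHS](reindex_inj (@perm_inj _ g^-1%g)) /=.
apply: eq_big => [k|k _]; first by rewrite perm_closed ?perm_onV.
rewrite -!regular_mxM; congr (aG _).
have gj: (g^-1)%g j = j by rewrite (out_perm (perm_onV Dg)).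
by rewrite -[in RHS]gj -tpermJ conjgE invgK -!mulgA mulVg mulg1.
Qed.

Lemma Zmx_murphy e : Zmx e D *m murphy = murphy *m Zmx e D.
Proof.
rewrite ZmxE mulmx_suml mulmx_sumr; apply: eq_bigr => v Dv.
by rewrite -scalemxAl -scalemxAr murphy_comm.
Qed.

(** In the decomposition by the image [k] of [j], the term [k = j] gains a factor [M] in the number
    of colorings. The other terms keep that number and assemble into the Jucys-Murphy element, with
    the sign of a transposition. *)
Lemma Zmx_step e :
  Zmx e (j |: D) = M%:R *: Zmx e D + (-1) ^+ e *: (Zmx e D *m murphy).
Proof.
rewrite [LHS]ZmxE sum_Sym_step big_setU1 //=; congr (_ + _).
  rewrite ZmxE scaler_sumr; apply: eq_bigr => v Dv.
  rewrite ncol_step ?setU11 // eqxx tperm1 mulg1 scalerA; congr (_ *: _).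
  by rewrite natrM mulrCA.
rewrite /murphy mulmx_sumr scaler_sumr; apply: eq_bigr => k Dk.
have neq_kj: k != j by apply: contraNneq Dj => <-.
rewrite ZmxE mulmx_suml scaler_sumr; apply: eq_bigr => v Dv.
rewrite ncol_step ?setU1r // (negPf neq_kj) mul1n -scalemxAl -regular_mxM scalerA.
congr (_ *: _); rewrite sgnM mulrAC mulrC; congr (_ * _).
by rewrite /sgn odd_tperm neq_kj andbT.
Qed.

End Step.

(** * Second moments of a positive definite class function *)

Section PositiveClassFunction.

Variable chi : {perm T} -> R.
Hypothesis chi_class : forall x y : {perm T}, chi (x * y)%g = chi (y * x)%g.
Hypothesis chi_psd : forall y : {perm T} -> R,
  0 <= \sum_u \sum_v y u * y v * chi (u^-1 * v)%g.
Local Notation tau := (gtau chi).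

(** Both factors are symmetric and idempotent up to a positive scalar, so by the trace property
    [tau (A *m B)] is a positive multiple of [tau ((B *m A)^T *m (B *m A))]. *)
Lemma symmetrizer_prod_ge0 K L :
  0 <= tau (symmetrizer true K *m symmetrizer false L).
Proof.
set A := symmetrizer true K; set B := symmetrizer false L.
have inA : (A \in R_G)%MS := symmetrizer_in _ _ _.
have inB : (B \in R_G)%MS := symmetrizer_in _ _ _.
have: 0 <= tau ((B *m A)^T *m (B *m A)).
  by apply: gtau_psd; rewrite ?envelop_mxM.
rewrite trmx_mul !tr_symmetrizer -!mulmxA gtauC ?envelop_mxM //.
rewrite (mulmxA B) symmetrizer_sq -!mulmxA symmetrizer_sq -scalemxAl -scalemxAr.
by rewrite !linearZ /= -gtauC // !pmulr_rge0 ?ltr0n ?cardG_gt0.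
Qed.

(** The product is a sum of squares. Each antisymmetrizer [S] in [Zmx true D] is a multiple of its
    square and commutes with [Zmx false D], so one copy of [S] moves to the right. Each symmetrizer
    between the two copies is again a multiple of its square. *)
Lemma Zmx_prod_psd D (U : 'M[R]_#|G|) : (U \in R_G)%MS ->
  0 <= tau (U^T *m (Zmx true D *m Zmx false D) *m U).
Proof.
move=> inU; rewrite {1}/Zmx mulmx_suml mulmx_sumr mulmx_suml linear_sum sumr_ge0 //=.
move=> b _; set K := (Sym_group D :&: fixing_group b)%G.
have comm_Z: symmetrizer true K *m Zmx false D = Zmx false D *m symmetrizer true K.
  rewrite mulmx_suml mulmx_sumr; apply: eq_bigr => k /setIP[Dk _].
  by rewrite -scalemxAl -scalemxAr Zmx_comm.
rewrite -(pmulr_rge0 _ (_ : 0 < #|K|%:R)) ?ltr0n ?cardG_gt0 //.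
rewrite -gtauZ scalemxAl scalemxAr scalemxAl -symmetrizer_sq -mulmxA.
rewrite -(mulmxA (symmetrizer _ _)) comm_Z.
have := tr_symmetrizer R true K; have := symmetrizer_in R true K.
move: (symmetrizer true K) => S inS trS; rewrite /Zmx.
rewrite mulmx_suml !mulmx_sumr mulmx_suml mulmx_sumr linear_sum sumr_ge0 //= => a _.
set L := (Sym_group D :&: fixing_group a)%G.
rewrite -(pmulr_rge0 _ (_ : 0 < #|L|%:R)) ?ltr0n ?cardG_gt0 //.
have: (symmetrizer false L *m S *m U \in R_G)%MS.
  by rewrite !envelop_mxM ?symmetrizer_in.
move/(gtau_psd chi_psd); rewrite !trmx_mul tr_symmetrizer trS !mulmxA.
rewrite -(mulmxA _ (symmetrizer false L) (symmetrizer false L)) symmetrizer_sq.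
by rewrite -gtauZ -!scalemxAr -!scalemxAl.
Qed.

Definition Zprod D := tau (Zmx true D *m Zmx false D).

(** With [X] the Jucys-Murphy element, which commutes with both factors [A] and [B], the new product
    is M^2 A B - X A B X. The subtracted term has nonnegative value by [Zmx_prod_psd], as [X] is
    symmetric. *)
Lemma Zprod_step D j : j \notin D -> Zprod (j |: D) <= M%:R ^+ 2 * Zprod D.
Proof.
move=> Dj; rewrite /Zprod !Zmx_step // expr1 expr0 scale1r scaleN1r.
have := Zmx_prod_psd D (murphy_in D j); rewrite tr_murphy.
have := Zmx_murphy Dj true; have := Zmx_murphy Dj false.
move: (Zmx true D) (Zmx false D) (murphy D j) => A B X commB commA.
rewrite mulmxDl !mulmxDr !mulNmx -!scalemxAl -!scalemxAr scalerA.
have ->: A *m X *m B = A *m (B *m X) by rewrite -mulmxA commB.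
have ->: A *m X *m (B *m X) = X *m (A *m B) *m X by rewrite commA !mulmxA.
by rewrite addrA addrK linearB /= gtauZ expr2 gerBl.
Qed.

Lemma Zprod_set0 : Zprod set0 = chi 1%g.
Proof.
have Zmx0 e : Zmx e set0 = 1%:M.
  have fix0 v : v \in Sym set0 -> v = 1%g.
    by rewrite inE => /perm_on_id-> //; rewrite cards0.
  rewrite ZmxE (bigD1 1%g) ?group1 //= big1 ?addr0 => [|v /andP[/fix0->]]; last first.
    by rewrite eqxx.
  rewrite (_ : ncol _ _ = 1%N) ?mulr1.
    by rewrite /sgn odd_perm1 andbF expr0 scale1r repr_mx1.
  apply/eqP/cards1P; exists [ffun=> ord0]; apply/setP=> a; rewrite in_set in_set1.
  rewrite group1 andbT; apply/coloringsP/eqP => [a0 | -> x _]; last by rewrite ffunE.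
  by apply/ffunP=> x; rewrite ffunE a0 ?inE.
by rewrite /Zprod !Zmx0 mulmx1 -(repr_mx1 aG) gtauG.
Qed.

Lemma Zprod_le D : Zprod D <= M%:R ^+ #|D|.*2 * chi 1%g.
Proof.
move def_k: #|D| => k; elim: k D def_k => [|k IHk] D.
  by move/cards0_eq->; rewrite Zprod_set0 mul1r.
move=> cardD; have [j Dj | j0] := pickP [in D]; last by rewrite (eq_card0 j0) in cardD.
have := cardsD1 j D; rewrite Dj cardD add1n => -[/esym cardDj].
rewrite -(setD1K Dj); apply: le_trans (Zprod_step _) _; first by rewrite setD11.
by rewrite doubleS !exprS expr0 mulr1 -!mulrA !ler_pM2l ?ltr0n ?IHk.
Qed.

End PositiveClassFunction.

(** * The normalized character as a signed count of fillings *)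

Section BoxCharacter.

Variables r c : T -> 'I_M.

(* [#|T|`!] times the normalized character, when [fixing r] and [fixing c] are
   the row and column stabilizers of a diagram with set of boxes [T]. *)
Definition box_char (h : {perm T}) : R :=
  \sum_(f : {perm T}) \sum_(q in fixing c)
    sgn true q * ((q^-1 * h ^ f)%g \in fixing r)%:R.

Lemma box_charJ (h x : {perm T}) : box_char (h ^ x)%g = box_char h.
Proof.
rewrite /box_char [RHS](reindex_inj (mulgI x)) /=; apply: eq_bigr => f _.
by apply: eq_bigr => q _; rewrite conjgM.
Qed.

Lemma box_char_class (x y : {perm T}) : box_char (x * y)%g = box_char (y * x)%g.
Proof. by rewrite -(box_charJ (x * y) x) conjgE !mulgA mulVg mul1g. Qed.

(** This exhibits [box_char] as a Gram matrix. For fixed column permutations [q] and [p], the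
    elements [z] that satisfy both row conditions form a coset of [fixing r] or the empty set. *)
Lemma box_char_gram (u v : {perm T}) :
  #|fixing r|%:R * #|fixing c|%:R * box_char (u^-1 * v)%g
    = \sum_(f : {perm T}) \sum_(z : {perm T})
        (\sum_(q in fixing c) sgn true q * ((z^-1 * (u * f * q))%g \in fixing r)%:R)
      * (\sum_(q in fixing c) sgn true q * ((z^-1 * (v * f * q))%g \in fixing r)%:R).
Proof.
pose E (f q p : {perm T}) : R := ((u * f * q)^-1 * (v * f * p) \in fixing r)%g%:R.
have count_z f q p :
  \sum_(z : {perm T}) ((z^-1 * (u * f * q))%g \in fixing r)%:R
     * ((z^-1 * (v * f * p))%g \in fixing r)%:R = #|fixing r|%:R * E f q p.
  set x := (u * f * q)%g; set y := (v * f * p)%g.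
  rewrite (reindex_inj (mulgI x)) (reindex_inj invg_inj) /= -sum1_card natr_sum.
  rewrite big_distrl [RHS]big_mkcond /=; apply: eq_bigr => z _.
  rewrite invMg invgK mulgKV -mulgA; case: ifP => [Pz | _]; last by rewrite mul0r.
  by rewrite /E groupMl.
transitivity (#|fixing r|%:R * \sum_f \sum_(q in fixing c) \sum_(p in fixing c)
    sgn true q * sgn true p * E f q p); last first.
  rewrite mulr_sumr; apply: eq_bigr => f _; rewrite mulr_sumr.
  under [RHS]eq_bigr do rewrite mulr_suml.
  rewrite [RHS]exchange_big; apply: eq_bigr => q _; rewrite mulr_sumr.
  under [RHS]eq_bigr do rewrite mulr_sumr.
  rewrite [RHS]exchange_big; apply: eq_bigr => p _.
  rewrite mulrCA -count_z mulr_sumr; apply: eq_bigr => z _.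
  by rewrite mulrACA.
rewrite -mulrA; congr (_ * _).
under [RHS]eq_bigr do rewrite exchange_big.
rewrite exchange_big /= -sumr_const mulr_suml; apply: eq_bigr => p Qp.
(* Replacing [f] by [f * p^-1] and [q] by [p * q] removes [p] from the summand, so the sum over [p]
   yields the factor [#|fixing c|]. *)
rewrite mul1r [RHS](reindex_inj (mulIg p^-1%g)); apply: eq_bigr => f _.
rewrite [RHS](reindex_inj (mulgI p)); apply: eq_big => [q | q _] /=.
  by rewrite groupMl.
rewrite sgnM [sgn _ _ * _ * sgn _ _]mulrAC /sgn -signr_addb addbb mul1r.
suff ->: (q^-1 * (u^-1 * v) ^ f
    = (u * (f * p^-1) * (p * q))^-1 * (v * (f * p^-1) * p))%g.
  by [].
by rewrite conjgE !invMg !mulgA invgK !mulgKV.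
Qed.

Lemma box_char_psd (y : {perm T} -> R) :
  0 <= \sum_u \sum_v y u * y v * box_char (u^-1 * v)%g.
Proof.
rewrite -(pmulr_rge0 _ (_ : 0 < #|fixing r|%:R * #|fixing c|%:R)); last first.
  by rewrite mulr_gt0 ?ltr0n ?cardG_gt0.
pose w f z u : R :=
  \sum_(q in fixing c) sgn true q * ((z^-1 * (u * f * q))%g \in fixing r)%:R.
rewrite (_ : _ * _ = \sum_f \sum_z (\sum_u y u * w f z u) ^+ 2).
  by apply: sumr_ge0 => f _; apply: sumr_ge0 => z _; apply: sqr_ge0.
transitivity (\sum_u \sum_v \sum_f \sum_z (y u * w f z u) * (y v * w f z v)).
  rewrite mulr_sumr; apply: eq_bigr => u _; rewrite mulr_sumr.
  apply: eq_bigr => v _; rewrite mulrCA box_char_gram mulr_sumr.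
  by apply: eq_bigr => f _; rewrite mulr_sumr; apply: eq_bigr => z _; rewrite mulrACA.
under eq_bigr do rewrite exchange_big.
rewrite exchange_big; apply: eq_bigr => f _.
under eq_bigr do rewrite exchange_big.
rewrite exchange_big; apply: eq_bigr => z _.
by rewrite expr2 mulr_suml; apply: eq_bigr => u _; rewrite mulr_sumr.
Qed.

Hypothesis rc_inj : forall x y, r x = r y -> c x = c y -> x = y.

Lemma fixing_rc_trivial (q : {perm T}) : q \in fixing r -> q \in fixing c -> q = 1%g.
Proof.
move=> /fixingP qr /fixingP qc; apply/permP=> x; rewrite perm1.
exact: rc_inj (qr x) (qc x).
Qed.

Lemma box_char1 : box_char 1%g = #|T|`!%:R.
Proof.
rewrite /box_char -(cardsT T) -card_Sym -sum1_card natr_sum; apply: eq_big => [f|f _].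
  by rewrite inE; apply/esym/subsetP=> x; rewrite inE.
rewrite (bigD1 1%g) ?group1 //= conj1g invg1 mulg1 group1 big1 => [|q /andP[Qq q1]].
  by rewrite addr0 /sgn odd_perm1 mulr1.
rewrite mulg1 groupV; case: (boolP (q \in _)) => [Pq | _]; last by rewrite mulr0.
by rewrite (fixing_rc_trivial Pq Qq) eqxx in q1.
Qed.

Definition restrict D (a : T -> 'I_M) : {ffun T -> 'I_M} :=
  [ffun x => if x \in D then a x else ord0].

Lemma restrict_colorings D (a : T -> 'I_M) : restrict D a \in colorings D.
Proof. by apply/coloringsP=> x /negPf Dx; rewrite ffunE Dx. Qed.

Lemma fixing_restrict D (a : T -> 'I_M) (s : {perm T}) : s \in Sym D ->
  (s \in fixing (restrict D a)) = (s \in fixing a).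
Proof.
rewrite inE => Ds; apply/fixingP/fixingP=> fix_s x; have:= fix_s x; rewrite !ffunE.
  rewrite perm_closed //; case: ifPn => // Dx _; by rewrite (out_perm Ds Dx).
by rewrite perm_closed // => ->.
Qed.

(** A contributing column permutation [q] is supported on [D]: as [h] is trivial off [D], there [q]
    preserves rows as well as columns, hence fixes each point. The term of [f] therefore depends
    only on the restriction of the filling to [D]. *)
Lemma box_charE D (h : {perm T}) : h \in Sym D -> box_char h =
  \sum_(f : {perm T}) \sum_(q in Sym D :&: fixing (restrict D (c \o f)))
   sgn true q * ((q^-1 * h)%g \in Sym D :&: fixing (restrict D (r \o f)))%:R.
Proof.
move=> Dh; apply: eq_bigr => f _.
rewrite (reindex_inj (conjg_inj f)) /= [LHS]big_mkcond [RHS]big_mkcond.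
apply: eq_bigr => q _.
have fixf (a : T -> 'I_M) (s : {perm T}) : (s ^ f \in fixing a)%g = (s \in fixing (a \o f)).
  rewrite -(fixingJ (a \o f) s f).
  by apply/fixingP/fixingP=> fix_s x; have:= fix_s x; rewrite /= !permKV.
rewrite -conjVg -conjMg !fixf !in_setI.
have sgnJ: sgn true (q ^ f)%g = sgn true q by rewrite /sgn odd_permJ.
rewrite sgnJ; case: (boolP (q \in Sym D)) => [Dq | nDq] /=.
  have Dqh: (q^-1 * h)%g \in Sym D by rewrite groupM ?groupV.
  by rewrite !fixing_restrict // Dqh.
case: ifP => // /fixingP fix_q; case: (boolP (_ \in fixing _)) => [/fixingP fix_qh|_].
  case/negP: nDq; rewrite inE; apply/subsetP=> x; rewrite inE; apply: contraR => Dx.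
  apply/eqP/(@perm_inj _ f)/rc_inj; last exact: fix_q.
  have:= fix_qh (q x); rewrite permM permK /= => <-.
  by move: Dh; rewrite inE => /out_perm->.
by rewrite mulr0.
Qed.

Lemma sum_box_char_sq D :
  \sum_(h in Sym D) box_char h ^+ 2
    <= #|~: D|`!%:R * (M%:R ^+ #|D|.*2 * #|T|`!%:R).
Proof.
pose S e a := symmetrizer e (Sym D :&: fixing a).
pose H (p : {ffun T -> 'I_M} * {ffun T -> 'I_M}) :=
  gtau box_char (S true p.2 *m S false p.1).
have H_ge0 p : 0 <= H p.
  exact: (symmetrizer_prod_ge0 box_char_class box_char_psd
    (Sym_group D :&: fixing_group p.2)%G (Sym_group D :&: fixing_group p.1)%G).
pose phi (f : {perm T}) := (restrict D (r \o f), restrict D (c \o f)).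
(* [box_charE] expands one factor [box_char h]; summing over [h] against the other factor gives
   [gtau] of an antisymmetrizer times a symmetrizer. *)
have ->: \sum_(h in Sym D) box_char h ^+ 2 = \sum_f H (phi f).
  transitivity (\sum_(h in Sym D) \sum_(f : {perm T})
    \sum_(q in Sym D :&: fixing (restrict D (c \o f)))
     sgn true q * ((q^-1 * h)%g \in Sym D :&: fixing (restrict D (r \o f)))%:R
       * box_char h).
    apply: eq_bigr => h Dh; rewrite expr2 {1}(box_charE Dh) mulr_suml.
    by apply: eq_bigr => f _; rewrite mulr_suml.
  rewrite exchange_big; apply: eq_bigr => f _; rewrite exchange_big /=.
  rewrite /H /S mulmx_suml linear_sum /=; apply: eq_bigr => q /setIP[Dq _].
  rewrite -scalemxAl gtauZ mulmx_sumr linear_sum mulr_sumr /=.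
  rewrite (reindex_inj (mulgI q)) /= [LHS]big_mkcond [RHS]big_mkcond /=.
  apply: eq_bigr => p _; rewrite groupMl // mulKg -scalemxAr gtauZ -regular_mxM gtauG.
  rewrite in_setI [sgn false p]expr0 mul1r.
  by case: (p \in Sym D); case: (p \in fixing _); rewrite /= ?mulr1 ?mulr0 ?mul0r.
apply: le_trans (_ : #|~: D|`!%:R * Zprod box_char D <= _); last first.
  rewrite ler_pM2l ?ltr0n ?fact_gt0 // -box_char1.
  exact: Zprod_le box_char_psd D.
have ->: Zprod box_char D =
    \sum_(p | (p.1 \in colorings D) && (p.2 \in colorings D)) H p.
  rewrite -(pair_big [in colorings D] [in colorings D] (fun a b => H (a, b))) /=.
  rewrite exchange_big /Zprod mulmx_suml linear_sum /=; apply: eq_bigr => b _.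
  by rewrite mulmx_sumr linear_sum /=.
rewrite (partition_big phi
  (fun p => (p.1 \in colorings D) && (p.2 \in colorings D))); last first.
  by move=> f _; rewrite /= !restrict_colorings.
rewrite mulr_sumr; apply: ler_sum => p _.
rewrite (eq_bigr (fun=> H p)) => [|f /eqP-> //]; rewrite sumr_const mulr_natl.
apply: ler_wpMn2l => //.
(* Pairs of colorings that come from no filling only need [H p] to be nonnegative. Otherwise, two
   fillings with the same restriction differ by a permutation of the complement of [D]. *)
have [f0 /eqP phi_f0 | phi0] := pickP [pred f | phi f == p]; last first.
  by rewrite (eq_card0 phi0).
rewrite -card_Sym -(card_imset _ (mulIg f0^-1%g)); apply/subset_leq_card/subsetP=> s.
case/imsetP=> f; rewrite unfold_in -phi_f0.
case/andP=> /eqP/ffunP eq_r /eqP/ffunP eq_c ->.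
rewrite inE; apply/subsetP=> x; rewrite !inE permM; apply: contra => Dx.
rewrite (can2_eq (permKV f0) (permK f0)); apply/eqP/rc_inj.
  by have:= eq_r x; rewrite !ffunE Dx.
by have:= eq_c x; rewrite !ffunE Dx.
Qed.

End BoxCharacter.

End JucysMurphy.

(** * The character of a Specht module *)

Section YoungSymmetrizer.

Variables (T : finType) (r c : T -> nat) (len : nat -> nat).
Hypothesis c_lt : forall x, (c x < len (r x))%N.
Hypothesis rc_onto : forall x k, (k < len (r x))%N -> exists2 z, r z = r x & c z = k.
Hypothesis rc_inj : forall x y, r x = r y -> c x = c y -> x = y.
Local Notation P := (fixing r).
Local Notation Q := (fixing c).

(** The box of column [k] in the row of [x]; the default is returned only when that row has no such
    box. *)
Definition box_at x k : T := odflt x [pick z | (r z == r x) && (c z == k)].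

Lemma box_atP x k : (k < len (r x))%N -> r (box_at x k) = r x /\ c (box_at x k) = k.
Proof.
rewrite /box_at => /rc_onto[z rz cz]; case: pickP => [y /andP[/eqP ? /eqP ?] // | no_z].
by have:= no_z z; rewrite rz cz !eqxx.
Qed.

(* With [k := len (r x)], [psi] injects the boxes that [w] sends to the first [k]
   columns into those columns; as [w] is a bijection, [psi] is onto, and it is
   the identity on the rows of length at most [k], such as that of [x]. *)
Lemma transversal_col_lt (w : {perm T}) :
    (forall x y, r x = r y -> c (w x) = c (w y) -> x = y) ->
  forall x, (c (w x) < len (r x))%N.
Proof.
move=> w_inj x; set k := len (r x).
pose A := [set y | (c (w y) < k)%N]; pose B := [set y | (c y < k)%N].
pose psi y := if (len (r y) <= k)%N then y else box_at y (c (w y)).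
have psiE y : y \in A -> r (psi y) = r y /\
    c (psi y) = if (len (r y) <= k)%N then c y else c (w y).
  rewrite inE /psi => Ay; case: leqP => // lt_k.
  exact: box_atP (ltn_trans Ay lt_k).
have psi_inj : {in A &, injective psi}.
  move=> y z Ay Az eq_psi; have [ry cy] := psiE y Ay; have [rz cz] := psiE z Az.
  have ryz: r y = r z by rewrite -ry -rz eq_psi.
  move: cy; rewrite eq_psi cz ryz; case: leqP => _ cyz; first exact: rc_inj.
  exact: w_inj.
have cardAB: #|A| = #|B|.
  rewrite -(card_imset A (@perm_inj _ w)); apply: eq_card => y.
  apply/imsetP/idP => [[z Az ->] | By]; first by rewrite !inE in Az *.
  by exists (w^-1%g y); rewrite ?permKV // !inE permKV in By *.
have psiAB: psi @: A \subset B.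
  apply/subsetP=> _ /imsetP[y Ay ->]; have [_ cy] := psiE y Ay.
  rewrite inE cy; case: (leqP (len (r y)) k) => [le_k | _].
    exact: leq_trans (c_lt y) le_k.
  by rewrite inE in Ay.
have /eqP psiAB_eq: psi @: A == B by rewrite eqEcard psiAB card_in_imset // cardAB leqnn.
have: x \in B by rewrite inE c_lt.
rewrite -psiAB_eq => /imsetP[y Ay def_x]; have [ry _] := psiE y Ay.
have ryx: r y = r x by rewrite -ry -def_x.
by move: def_x Ay; rewrite /psi ryx leqnn inE => <-.
Qed.

(** If [w] sends no two boxes of a row to the same column, let [p] move each [x] within its row to
    column [c (w x)], a column of that row by [transversal_col_lt]. Then [p^-1 * w] preserves
    columns. *)
Lemma young_dichotomy (w : {perm T}) :
  (exists p q, [/\ p \in P, q \in Q & w = p * q]%g) \/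
  (exists x y, [/\ x != y, r x = r y & c (w x) = c (w y)]).
Proof.
have [/existsP[x /existsP[y /and3P[neq_xy /eqP rxy /eqP cxy]]] | no_xy] := boolP
  [exists x, exists y, [&& x != y, r x == r y & c (w x) == c (w y)]].
  by right; exists x, y.
have w_inj x y : r x = r y -> c (w x) = c (w y) -> x = y.
  move=> rxy cxy; apply: contraNeq no_xy => neq_xy.
  by apply/existsP; exists x; apply/existsP; exists y; rewrite neq_xy rxy cxy !eqxx.
have pP x := box_atP (transversal_col_lt w_inj x).
have p_inj : injective (fun x => box_at x (c (w x))).
  move=> x y eq_p; have [rx cx] := pP x; have [ry cy] := pP y.
  by apply: w_inj; [rewrite -rx -ry eq_p | rewrite -cx -cy eq_p].
left; exists (perm p_inj), ((perm p_inj)^-1 * w)%g; split; last by rewrite mulKVg.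
  by apply/fixingP=> x; rewrite permE; case: (pP x).
apply/fixingP=> z; rewrite permM; set x := (perm p_inj)^-1%g z.
by rewrite -[z in RHS](permKV (perm p_inj)) -/x permE; case: (pP x) => _ ->.
Qed.

Variable F : fieldType.
Hypothesis char_neq2 : 2%:R != 0 :> F.
Local Notation G := [set: {perm T}]%G.
Local Notation aG := (regular_repr F G).
Local Notation A := (symmetrizer F false P).
Local Notation B := (symmetrizer F true Q).

(** Either [w] is a row permutation times a column permutation, both absorbed, or a transposition of
    [P] is conjugated by [w] into [Q]: [A] absorbs it with sign +, [B] with sign -, and the product
    vanishes. *)
Lemma young_sandwich (w : {perm T}) : exists k, A *m aG w *m B = k *: (A *m B).
Proof.
have [[p [q [Pp Qq ->]]] | [x [y [neq_xy rxy cxy]]]] := young_dichotomy w.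
  exists (sgn F true q); rewrite regular_mxM mulmxA -mulmxA symmetrizerMr //.
  by rewrite symmetrizerMl // [sgn F false p]expr0 scale1r -scalemxAr.
exists 0; rewrite scale0r.
have fix_t (a : T -> nat) u v : a u = a v -> tperm u v \in fixing a.
  by move=> auv; apply/fixingP=> z; case: tpermP => // ->.
have eq_t: (tperm x y * w = w * tperm (w x) (w y))%g by rewrite -tpermJ -conjgC.
have: A *m aG w *m B = - (A *m aG w *m B).
  have At: A *m aG (tperm x y) = A.
    by rewrite symmetrizerMr ?fix_t // [sgn F false _]expr0 scale1r.
  rewrite -{1}At.
  rewrite -(mulmxA A (aG (tperm x y)) (aG w)) -regular_mxM eq_t regular_mxM mulmxA -mulmxA.
  rewrite symmetrizerMl ?fix_t // /sgn odd_tperm (inj_eq perm_inj) neq_xy expr1.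
  by rewrite scaleN1r mulmxN.
move/eqP; rewrite -addr_eq0 -mulr2n -scaler_nat scaler_eq0 (negPf char_neq2).
by move/eqP.
Qed.

Lemma young_symmetrizer_sq : exists k, (A *m B) *m (A *m B) = k *: (A *m B).
Proof.
have: (B *m A \in group_ring F G)%MS by rewrite envelop_mxM ?symmetrizer_in.
case/envelop_mxP=> a def_BA.
rewrite mulmxA -(mulmxA A B A) def_BA; elim/big_ind: _ => [|X Y [k kX] [l lY]|w _].
- by exists 0; rewrite mulmx0 mul0mx scale0r.
- by exists (k + l); rewrite mulmxDr mulmxDl kX lY scalerDl.
have [k def_k] := young_sandwich w; exists (a w * k).
by rewrite -scalemxAr -scalemxAl def_k scalerA.
Qed.

End YoungSymmetrizer.

(** * The trace on the right ideal of a quasi-idempotent *)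

Section CyclicTrace.

Variables (F : fieldType) (gT : finGroupType).
Local Notation G := [set: gT]%G.
Local Notation aG := (regular_repr F G).
Variables (Y : 'M[F]_#|G|) (kappa : F).
Hypothesis Y_in : (Y \in group_ring F G)%MS.
Hypothesis Y_sq : Y *m Y = kappa *: Y.
Local Notation y := (gring_row Y).
Local Notation U := (cyclic_mx aG y).

(* The matrix of left multiplication by [Y]; it is [kappa] times a projection
   onto the right ideal [U]. *)
Let L : 'M[F]_#|G| := enveloping_algebra_mx aG *m lin_mul_row y.

Lemma mul_left_mx (x : 'rV[F]_#|G|) : x *m L = y *m gring_mx aG x.
Proof. by rewrite /L mulmxA mul_rV_lin1. Qed.

Lemma row_left_mx k : row k L = gring_row (Y *m aG (enum_val k)).
Proof. by rewrite row_mul rowK mul_rV_lin1 /= mxvecK gring_row_mul. Qed.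

Lemma left_mx_sq : L *m L = kappa *: L.
Proof.
apply/row_matrixP=> k; rewrite row_mul linearZ /= mul_left_mx row_left_mx.
have ->: gring_mx aG (gring_row (Y *m aG (enum_val k))) = Y *m aG (enum_val k).
  by rewrite gring_rowK ?envelop_mxM ?envelop_mx_id ?inE.
by rewrite -gring_row_mul mulmxA Y_sq -scalemxAl linearZ.
Qed.

(** As [L] has image in [U] and acts on [U] as [kappa], the left-hand side is the trace of
    [L *m aG s] on the whole algebra, which is read off in the basis of group elements. *)
Lemma trace_cyclic_mx (s : gT) :
  kappa * \tr (submod_repr (cyclic_mx_module aG y) s)
    = \sum_g (Y *m aG (g * s)%g) (gring_index G 1%g) (gring_index G g).
Proof.
set Ums := cyclic_mx_module aG y; set B : 'M_(\rank U, _) := val_submod 1%:M.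
have L_U : (L <= U)%MS by rewrite /cyclic_mx genmxE.
have U_L (W : 'M_(\rank U, _)) : (W <= U)%MS -> W *m L = kappa *: W.
  by rewrite /cyclic_mx genmxE => /submxP[Z ->]; rewrite -mulmxA left_mx_sq -scalemxAr.
have B_U : (B *m aG s <= U)%MS.
  by rewrite (mxmodule_trans Ums) ?inE ?val_submodP.
transitivity (\tr (L *m aG s)).
  rewrite -mxtraceZ -[_ *: _]/(_ *: in_submod U (B *m aG s)) -linearZ /= -U_L //.
  rewrite (_ : in_submod U _ = B *m aG s *m in_submod U L); last first.
    by rewrite [LHS]in_submodE [in RHS]in_submodE !mulmxA.
  by rewrite mxtrace_mulC mulmxA -val_submodE in_submodK.
rewrite /mxtrace (reindex (gring_index G)) /=; last first.
  by exists enum_val => [g _ | k _]; rewrite ?gring_indexK ?gring_valK ?inE.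
apply: eq_bigr => g _; set k := gring_index G g.
have rowLs: row k (L *m aG s) = gring_row (Y *m aG (g * s)%g).
  rewrite row_mul row_left_mx gring_indexK ?inE // -gring_row_mul.
  by rewrite -mulmxA -regular_mxM.
by move/rowP/(_ k): rowLs; rewrite [LHS]mxE [RHS]mxE.
Qed.

End CyclicTrace.

Lemma young_symmetrizerE (F : fieldType) (T : finType) (P Q : {set {perm T}}) :
  \sum_(p in P) \sum_(q in Q) (-1) ^+ q *: regular_repr F [set: {perm T}] (p * q)%g
    = symmetrizer F false P *m symmetrizer F true Q.
Proof.
rewrite mulmx_suml; apply: eq_bigr => p _; rewrite mulmx_sumr; apply: eq_bigr => q _.
by rewrite [sgn F false p]expr0 scale1r -scalemxAr -regular_mxM.
Qed.

Section SpechtCharacter.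

Variables (F : numFieldType) (n : nat) (la : seq nat).
Hypothesis sum_la : sumn la = n.
Local Notation P := (row_stab n la).
Local Notation Q := (col_stab n la).
Local Notation G := [set: 'S_n]%G.
Local Notation aG := (regular_repr F G).

Lemma box_inj (k l : 'I_n) : reshape_index la k = reshape_index la l ->
  reshape_offset la k = reshape_offset la l -> k = l.
Proof.
move=> eq_row eq_col; apply: val_inj.
by rewrite /= -(reshape_indexK la k) -(reshape_indexK la l) eq_row eq_col.
Qed.

(** The scalar is the one by which the square of the Young symmetrizer differs from itself; its
    value is recovered later from [s = 1]. *)
Lemma specht_trace : exists kappa : F, forall s : 'S_n,
  kappa * specht_char la F s =
    \sum_(f : 'S_n) \sum_(q in Q) (-1) ^+ q * ((q^-1 * s ^ f)%g \in P)%:R.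
Proof.
pose r (k : 'I_n) := reshape_index la k; pose c (k : 'I_n) := reshape_offset la k.
pose Y := \sum_(p in P) \sum_(q in Q) (-1) ^+ q *: aG (p * q)%g.
have YE : Y = symmetrizer F false (fixing r) *m symmetrizer F true (fixing c).
  exact: young_symmetrizerE.
have [kappa Y_sq] : exists k, Y *m Y = k *: Y.
  rewrite YE; apply: (young_symmetrizer_sq (len := nth 0%N la)).
  - by move=> k; apply: reshape_offsetP; rewrite sum_la.
  - move=> k l lt_l; have lt_n: (flatten_index la (r k) l < n)%N.
      by rewrite -sum_la; apply: flatten_indexP.
    exists (Ordinal lt_n); first exact: flatten_indexKl.
    exact: flatten_indexKr.
  - exact: box_inj.
  - by rewrite pnatr_eq0.
have Y_in : (Y \in group_ring F G)%MS.
  by rewrite YE envelop_mxM ?(symmetrizer_in F _ (fixing_group _)).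
exists kappa => s.
rewrite (trace_cyclic_mx Y_in Y_sq s) (reindex_inj invg_inj); apply: eq_bigr => f _.
  rewrite mulmx_suml summxE /=.
  (* With [g = f^-1], the coefficient selects p q f^-1 s = f^-1, that is, p = (q s^f)^-1. *)
  transitivity (\sum_(p in P) \sum_(q in Q)
      (-1) ^+ q * (p == (q * s ^ f)^-1)%g%:R : F).
    apply: eq_bigr => p _; rewrite mulmx_suml summxE; apply: eq_bigr => q _.
    rewrite -scalemxAl mxE -regular_mxM regular_mxE mul1g; congr (_ * _%:R).
    rewrite conjgE -(inj_eq (mulIg f)) mulVg eq_sym.
    by rewrite -[in RHS](inj_eq (mulIg (q * (f^-1 * (s * f)))%g)) mulVg !mulgA.
  rewrite exchange_big (reindex_inj invg_inj) /=; apply: eq_big => [q|q Qq].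
    by rewrite (groupV (fixing_group c)).
  rewrite -mulr_sumr odd_permV; congr (_ * _).
  rewrite -(groupV (fixing_group r)) /=.
  case: (boolP (_ \in _)) => [Pqs | nPqs].
    by rewrite (bigD1 _ Pqs) /= eqxx big1 ?addr0 // => p /andP[_ /negPf->].
  by rewrite big1 // => p Pp; case: eqP => // eq_p; rewrite -eq_p Pp in nPqs.
Qed.

End SpechtCharacter.

(** * Transposition length, cycles and centralizers *)

Section Cycles.

Variable n : nat.
Implicit Types s t : 'S_n.

Definition moved s : {set 'I_n} := [set x | s x != x].

Lemma moved_perm_on s : s \in Sym (moved s).
Proof. by rewrite inE; apply/subsetP=> x; rewrite !inE. Qed.

Lemma card_porbits_le s : (#|porbits s| <= n)%N.
Proof. by rewrite -[leqRHS]card_ord; apply: leq_imset_card. Qed.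

Lemma perm_neq1P s : s != 1%g -> exists x, s x != x.
Proof.
move=> s1; apply/existsP; apply: contraR s1 => /existsPn s_id; apply/eqP/permP=> x.
by rewrite perm1; apply/eqP; have:= s_id x; rewrite negbK.
Qed.

Lemma tperm_lengthP s : is_tperm_prod s (tperm_length s).
Proof. by rewrite /tperm_length; case: ex_minnP. Qed.

Lemma tperm_length_min s k : is_tperm_prod s k -> (tperm_length s <= k)%N.
Proof. by rewrite /tperm_length; case: ex_minnP => m _; apply. Qed.

Lemma tperm_length_mul s (x y : 'I_n) : x != y ->
  (tperm_length (tperm x y * s) <= (tperm_length s).+1)%N.
Proof.
move=> neq_xy; apply: tperm_length_min.
have /existsP[ts /andP[ts_d /eqP def_s]] := tperm_lengthP s.
apply/existsP; exists (cons_tuple (x, y) ts).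
by rewrite /= /dpair /= neq_xy ts_d big_cons /= -def_s eqxx.
Qed.

Lemma card_porbits_split s (x : 'I_n) : s x != x ->
  #|porbits (tperm x (s x) * s)| = #|porbits s|.+1.
Proof.
move=> sx; have := porbits_mul_tperm s x (s x).
have := mem_porbit s 1 x; rewrite expg1 porbit_sym => ->.
by rewrite eq_sym sx /= addn0 addn1.
Qed.

(** While [s] moves a point [x], multiplying by [tperm x (s x)] splits off a fixed point and so adds
    one cycle, at the cost of one transposition. *)
Lemma tperm_length_porbits s k : (n <= #|porbits s| + k)%N -> (tperm_length s <= k)%N.
Proof.
elim: k s => [|k IHk] s le_n; have [-> | /perm_neq1P[x sx]] := eqVneq s 1%g.
- by apply: tperm_length_min; apply/existsP; exists [tuple]; rewrite /= big_nil eqxx.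
- have := card_porbits_le (tperm x (s x) * s); rewrite card_porbits_split //.
  by rewrite ltnNge -[#|_|]addn0 le_n.
- apply: leq_trans (_ : 0 <= _)%N; last by [].
  by apply: tperm_length_min; apply/existsP; exists [tuple]; rewrite /= big_nil eqxx.
rewrite -[s](mulKg (tperm x (s x))) tpermV.
apply: leq_trans (tperm_length_mul _ _) _; first by rewrite eq_sym.
by rewrite ltnS IHk // card_porbits_split // addSnnS.
Qed.

Lemma moved_tperm_prod (ts : seq ('I_n * 'I_n)) :
  (#|moved (\prod_(t <- ts) tperm t.1 t.2)%g| <= (size ts).*2)%N.
Proof.
elim: ts => [|[x y] ts IHts] /=.
  by rewrite big_nil leqn0 cards_eq0; apply/eqP/setP=> x; rewrite !inE perm1 ?eqxx.
rewrite big_cons /=; set s := (\prod_(_ <- _) _)%g in IHts *.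
apply: (@leq_trans #|[set x; y] :|: moved s|).
  apply/subset_leq_card/subsetP=> z; rewrite !inE permM.
  by case: tpermP => [-> | -> | _ _ ->]; rewrite ?eqxx ?orbT.
apply: leq_trans (leq_card_setU _ _) _; rewrite doubleS -addn2 addnC leq_add //.
by rewrite cards2; case: (x != y).
Qed.

Lemma card_moved_le s : (#|moved s| <= (tperm_length s).*2)%N.
Proof.
have /existsP[ts /andP[_ /eqP def_s]] := tperm_lengthP s.
by rewrite {1}def_s -[leqRHS](congr1 double (size_tuple ts)) moved_tperm_prod.
Qed.

Definition cycles s : {set {set 'I_n}} := porbit s @: moved s.

Lemma porbit_moved s x y : y \in porbit s x -> (y \in moved s) = (x \in moved s).
Proof.
case/porbitP=> i ->; rewrite !inE -permM -expgSr expgS permM.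
by rewrite (inj_eq perm_inj).
Qed.

Lemma card_porbitsE s : (#|cycles s| + #|~: moved s| <= #|porbits s|)%N.
Proof.
have fixed x y : x \notin moved s -> y \in porbit s x -> y = x.
  rewrite inE negbK => /eqP sx /porbitP[i ->]; rewrite permX.
  by elim: i => //= i ->.
rewrite -(card_in_imset (f := porbit s) (D := ~: moved s)); last first.
  move=> x y /[!in_setC] Sx _ eq_xy; apply/esym/fixed => //.
  by rewrite eq_xy porbit_id.
rewrite -cardsUI [_ :&: _](_ : _ = set0) ?cards0 ?addn0.
  apply/subset_leq_card/subsetP=> B.
  by rewrite inE => /orP[] /imsetP[x _ ->]; apply: imset_f.
apply/setP=> B; rewrite !inE; apply/negP=> /andP[/imsetP[x Sx ->] /imsetP[y]].
rewrite in_setC => Sy eq_xy; have xy: x = y by apply: fixed; rewrite // -eq_xy porbit_id.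
by rewrite -xy Sx in Sy.
Qed.

(* An element of the centralizer is determined by its values at one point of
   each cycle. *)
Lemma card_cent_moved s : s != 1%g ->
  (#|'C_(Sym (moved s))[s]%g| <= #|moved s| ^ #|cycles s|)%N.
Proof.
move=> /perm_neq1P[x0 _]; pose rep (B : {set 'I_n}) := odflt x0 [pick x in B].
pose phi (z : 'S_n) := [ffun B => if B \in cycles s then z (rep B) else x0].
have repP x : rep (porbit s x) \in porbit s x.
  by rewrite /rep; case: pickP => //= /(_ x); rewrite porbit_id.
have phi_inj : {in 'C_(Sym (moved s))[s]%g &, injective phi}.
  move=> z t /setIP[Dz /cent1P sz] /setIP[Dt /cent1P st] /ffunP eq_zt.
  apply/permP=> x; have [Sx | nSx] := boolP (x \in moved s); last first.
    by move: Dz Dt; rewrite !inE => Dz Dt; rewrite (out_perm Dz nSx) (out_perm Dt nSx).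
  have:= eq_zt (porbit s x); rewrite !ffunE imset_f //.
  have commX u : commute s u ->
      forall i (y : 'I_n), u ((s ^+ i)%g y) = (s ^+ i)%g (u y).
    by move=> su i y; rewrite -!permM (commuteX i (commute_sym su)).
  have := repP x; rewrite porbit_sym => /porbitP[i def_x] eq_rep.
  by rewrite [x in LHS]def_x [x in RHS]def_x !commX ?eq_rep.
rewrite -(card_in_imset phi_inj) -(card_pffun_on x0); apply/subset_leq_card/subsetP.
move=> _ /imsetP[z /setIP[Dz _] ->]; apply/pffun_onP; split.
  by apply/subsetP=> B; rewrite inE ffunE; case: ifP => //; rewrite eqxx.
move=> _ /imageP[B SB ->]; rewrite ffunE SB; have /imsetP[x Sx ->] := SB.
move: Dz; rewrite inE => Dz.
by rewrite perm_closed // (porbit_moved (repP x)).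
Qed.

End Cycles.

Lemma tperm_length_cycles n (s : 'S_n) :
  (#|cycles s| + tperm_length s <= #|moved s|)%N.
Proof.
have le_c : (#|cycles s| <= #|moved s|)%N := leq_imset_card _ _.
have := cardsC (moved s); have := card_porbitsE s; rewrite card_ord => le_porb card_s.
have: (tperm_length s <= #|moved s| - #|cycles s|)%N.
  by apply: tperm_length_porbits; lia.
lia.
Qed.

(** * The final estimate *)

(** Bernoulli's inequality 1 - j/(n+1) <= (1 - 1/(n+1))^j, cleared of denominators. *)
Lemma bernoulli_expn n j : (j <= n.+1)%N ->
  ((n.+1 - j) * n.+1 ^ j <= n.+1 * n ^ j)%N.
Proof.
elim: j => [|j IHj] lt_j; first by rewrite !expn0 subn0.
have {}IHj := IHj (ltnW lt_j).
apply: (@leq_trans (n * ((n.+1 - j) * n.+1 ^ j))%N).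
  rewrite expnS !mulnA leq_mul2r; apply/orP; right.
  have [i ->] : exists i, n = (i + j)%N by exists (n - j)%N; rewrite subnK.
  by rewrite -addSn addnK addSn subSS addnK; nia.
by rewrite expnS (mulnCA n.+1) leq_mul2l IHj orbT.
Qed.

(** Split [k] into two halves, each at most (n+1)/2: by Bernoulli, each half costs a factor at most
    2. *)
Lemma expn_succ_le n k : (k <= n)%N -> (n.+1 ^ k <= 4 * n ^ k)%N.
Proof.
have half j : (j.*2 <= n.+1)%N -> (n.+1 ^ j <= 2 * n ^ j)%N.
  move=> le_j; have le_jn : (j <= n.+1)%N by lia.
  rewrite -(leq_pmul2l (ltn0Sn n)) mulnCA.
  apply: leq_trans (_ : 2 * ((n.+1 - j) * n.+1 ^ j) <= _)%N.
    by rewrite mulnA leq_mul2r; apply/orP; right; lia.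
  by rewrite leq_mul2l bernoulli_expn.
move=> le_kn; have -> : k = (k./2 + uphalf k)%N by lia.
by rewrite !expnD -[4%N]/(2 * 2)%N mulnACA leq_mul // half; lia.
Qed.

Lemma expn_fact_le n k : (k <= n)%N -> (n ^ k * (n - k)`! <= 4 ^ k * n`!)%N.
Proof.
elim: n k => [|n IHn] [|k] // le_kn.
have {}IHn := IHn k le_kn.
rewrite subSS expnS factS -mulnA [leqRHS]mulnCA leq_mul2l orFb.
apply: leq_trans (_ : 4 * (n ^ k * (n - k)`!) <= _)%N.
  by rewrite mulnA leq_mul2r expn_succ_le // orbT.
by rewrite expnS -mulnA leq_mul2l.
Qed.

Lemma char_estimate (R : rcfType) (C x : R) (n k l m : nat) :
    0 <= x -> (0 < l <= k)%N -> (k <= l.*2)%N -> (k <= n)%N ->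
    m%:R <= C * Num.sqrt n%:R ->
    x ^+ 2 * (k`! * n`!)%:R <= (k ^ (k - l) * ((n - k)`! * m ^ k.*2))%:R ->
  x <= ((1 + 16%:R * C ^+ 2) / Num.sqrt l%:R) ^+ l.
Proof.
move=> x_ge0 /andP[l_gt0 le_lk] le_kl le_kn le_m le_x.
have C16_ge0 : 0 <= 16%:R * C ^+ 2 by rewrite mulr_ge0 ?sqr_ge0 ?ler0n.
(* The 16 is 4 * 4, from the two uses of [expn_fact_le] below. Adding 1 makes [C0] at least 1, so
   that C0^k <= C0^(2l) follows from k <= 2l. *)
set C0 := 1 + _; have C0_ge1 : 1 <= C0 by rewrite lerDl.
have C0_ge0 : 0 <= C0 by apply: le_trans C0_ge1.
have k_gt0 : (0 < k)%N := leq_trans l_gt0 le_lk.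
have n_gt0 : (0 < n)%N := leq_trans k_gt0 le_kn.
have le_m2 : m%:R ^+ 2 <= C ^+ 2 * n%:R.
  rewrite -[n%:R]sqr_sqrtr ?ler0n // -exprMn lerXn2r ?nnegrE ?ler0n //.
  exact: le_trans le_m.
(* Multiplying by [c] completes k^l to k^k and n^k to n^k (n-k)!, the two products that
   [expn_fact_le] compares with factorials. *)
pose c := (k ^ (k - l) * (n ^ k * (n - k)`!))%N.
have c_gt0 : (0 < c)%N by rewrite !muln_gt0 !expn_gt0 k_gt0 n_gt0 fact_gt0.
have x2_le : x ^+ 2 * (l ^ l)%:R <= C0 ^+ l.*2.
  apply: le_trans (_ : x ^+ 2 * (k ^ l)%:R <= _).
    by rewrite ler_wpM2l ?sqr_ge0 // ler_nat leq_exp2r.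
  apply: le_trans (_ : (16%:R * C ^+ 2) ^+ k <= _); last first.
    apply: le_trans (_ : C0 ^+ k <= _); last exact: ler_weXn2l.
    by rewrite lerXn2r ?nnegrE // /C0 lerDr ler01.
  rewrite -(ler_pM2r (_ : 0 < c%:R)) ?ltr0n //.
  apply: le_trans (_ : x ^+ 2 * (16 ^ k * (k`! * n`!))%:R <= _).
    rewrite -mulrA ler_wpM2l ?sqr_ge0 // -natrM ler_nat /c mulnA -expnD subnKC //.
    have /= := leq_mul (expn_fact_le (leqnn k)) (expn_fact_le le_kn).
    by rewrite subnn fact0 muln1 mulnACA -expnMn.
  rewrite natrM mulrCA.
  apply: le_trans (_ : (16 ^ k)%:R * (k ^ (k - l) * ((n - k)`! * m ^ k.*2))%:R <= _).
    by rewrite ler_wpM2l ?ler0n.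
  rewrite exprMn -mulrA -natrX ler_wpM2l ?ler0n // /c !natrM.
  rewrite [leRHS]mulrCA ler_wpM2l ?ler0n // mulrA [leRHS]mulrC ler_wpM2l ?ler0n //.
  rewrite !natrX -mul2n exprM -exprMn lerXn2r //.
    by rewrite nnegrE exprn_ge0.
  by rewrite nnegrE mulr_ge0 ?sqr_ge0.
have sl_gt0 : 0 < Num.sqrt l%:R ^+ l :> R by rewrite exprn_gt0 // sqrtr_gt0 ltr0n.
rewrite expr_div_n ler_pdivlMr // -ler_sqr ?nnegrE ?exprn_ge0 ?mulr_ge0 //; last exact: ltW.
by rewrite exprMn exprAC sqr_sqrtr ?ler0n // -natrX -exprM muln2.
Qed.

Lemma box_char_le (R : realFieldType) (n m : nat) (r c : 'I_n -> 'I_m.+1) (s : 'S_n) :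
    (forall x y, r x = r y -> c x = c y -> x = y) -> s != 1%g ->
  box_char R r c s ^+ 2 * #|moved s|`!%:R
    <= (#|moved s| ^ (#|moved s| - tperm_length s)
        * ((n - #|moved s|)`! * m.+1 ^ #|moved s|.*2))%:R * n`!%:R.
Proof.
move=> rc_inj s1; set D := moved s; set k := #|D|.
have Ds : s \in Sym D := moved_perm_on s.
have le_sum : #|s ^: Sym D|%:R * box_char R r c s ^+ 2
    <= \sum_(h in Sym D) box_char R r c h ^+ 2.
  rewrite mulr_natl -sumr_const [leRHS](bigID [in s ^: Sym D]) /=.
  rewrite -[leLHS]addr0 lerD //; last by apply: sumr_ge0 => h _; apply: sqr_ge0.
  rewrite le_eqVlt; apply/orP; left; apply/eqP.
  apply: eq_big => [h | _ /imsetP[x _ ->]]; last by rewrite box_charJ.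
  apply/idP/andP => [| [] //]; move=> /[dup] /imsetP[x Dx ->] ?.
  by split=> //; rewrite groupJ.
have card_k : (k`! = #|'C_(Sym D)[s]%g| * #|s ^: Sym D|)%N.
  by rewrite /k -card_Sym -index_cent1 Lagrange ?subsetIl.
have le_bound := le_trans le_sum (sum_box_char_sq R rc_inj D).
rewrite card_k natrM mulrCA [_ ^+ 2 * _]mulrC.
apply: le_trans (ler_wpM2l (ler0n _ _) le_bound) _.
have cardC : #|~: D| = (n - k)%N by rewrite -[n in RHS]card_ord -(cardsC D) addKn.
rewrite cardC card_ord -natrX -!natrM ler_nat -!mulnA leq_mul2r; apply/orP; right.
apply: leq_trans (card_cent_moved s1) _.
have := tperm_length_cycles s; rewrite -/D -/k => le_c.
rewrite leq_pexp2l //; last by lia.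
have [x sx] := perm_neq1P s1.
by rewrite card_gt0; apply/set0Pn; exists x; rewrite inE.
Qed.

(** * Transfer to Specht modules and conclusion *)

Section SpechtBound.

Variable R : realType.
Variables (n : nat) (la : seq nat).

(** At [s = 1], [specht_trace] says that [kappa] times the dimension is n!. Hence neither factor
    vanishes, and [kappa] cancels in the quotient. *)
Lemma specht_ncharE m (r c : 'I_n -> 'I_m.+1) (s : 'S_n) : sumn la = n ->
    (forall k, r k = reshape_index la k :> nat) ->
    (forall k, c k = reshape_offset la k :> nat) ->
  specht_nchar la R[i] s = (box_char R r c s / n`!%:R)%:C.
Proof.
move=> sum_la rE cE; have [kappa trE] := specht_trace R[i] sum_la.
have P_E : row_stab n la = fixing r.
  apply/setP=> t; rewrite inE; apply/forallP/fixingP=> fix_t k.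
    by apply: val_inj; rewrite /= !rE; apply/eqP.
  by rewrite -!rE fix_t.
have Q_E : col_stab n la = fixing c.
  apply/setP=> t; rewrite inE; apply/forallP/fixingP=> fix_t k.
    by apply: val_inj; rewrite /= !cE; apply/eqP.
  by rewrite -!cE fix_t.
have rc_inj x y : r x = r y -> c x = c y -> x = y.
  by move=> eq_r eq_c; apply: (@box_inj n la); rewrite -?rE -?cE ?eq_r ?eq_c.
have boxE (t : 'S_n) : kappa * specht_char la R[i] t = (box_char R r c t)%:C.
  rewrite trE P_E Q_E /box_char rmorph_sum; apply: eq_bigr => f _.
  rewrite rmorph_sum; apply: eq_bigr => q _.
  by rewrite rmorphM rmorph_nat /sgn rmorph_sign.
have dimE : kappa * (specht_dim n la R[i])%:R = (n`!%:R)%:C.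
  rewrite -[n in n`!]card_ord -(box_char1 R rc_inj) -boxE.
  by rewrite /specht_char repr_mx1 mxtrace1.
have kd_neq0 : kappa * (specht_dim n la R[i])%:R != 0.
  by rewrite dimE rmorph_nat pnatr_eq0 -lt0n fact_gt0.
move: kd_neq0; rewrite mulf_eq0 negb_or => /andP[k_neq0 d_neq0].
by rewrite rmorphM fmorphV /= -boxE -dimE invfM mulrACA divff // mul1r.
Qed.

End SpechtBound.

(** The first row is the longest, and la_1 + la_1' - 1 is at least la_1 and la_1' because both are
    positive. So the diagram fits in a square of side [max_hook la]. *)
Lemma box_lt_max_hook n la (k : 'I_n) : is_partition n la ->
  (reshape_index la k < max_hook la)%N /\ (reshape_offset la k < max_hook la)%N.
Proof.
case/and3P=> sorted_la la_gt0 /eqP sum_la.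
have lt_k : (k < sumn la)%N by rewrite sum_la.
have := reshape_indexP lt_k; have := reshape_offsetP lt_k.
move: (reshape_index la k) (reshape_offset la k) => j l lt_l lt_j.
case: la sorted_la la_gt0 lt_l lt_j {sum_la lt_k} => //= a la path_la.
rewrite inE negb_or eq_sym -lt0n => /andP[a_gt0 _] lt_l lt_j.
rewrite /max_hook /=; have lt_la : (l < a)%N.
  case: j lt_l lt_j => //= j lt_l lt_j; apply: leq_trans lt_l _.
  have geq_trans : transitive geq by move=> x y z /= le_xy /leq_trans; apply.
  by have /allP := order_path_min geq_trans path_la; apply; apply: mem_nth.
by split; lia.
Qed.

Unset Implicit Arguments.

Theorem theorem1p2 (R : realType) (C : R) :
  0 < C ->
  exists (C0 : R) (n0 : nat),
    [/\ 0 < C0, (1 <= n0)%N &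
      forall (n : nat) (la : seq nat) (s : 'S_n),
        (n0 <= n)%N ->
        is_partition n la ->
        balanced C n la ->
        s != 1%g ->
        `|specht_nchar la R[i] s|
          <= ((C0 / Num.sqrt (tperm_length s)%:R) ^+ tperm_length s)%:C].
Proof.
move=> C_gt0; exists (1 + 16%:R * C ^+ 2), 1%N; split=> // [|n la s n_gt0 la_n bal_la s1].
  by rewrite ltr_wpDr // mulr_ge0 ?sqr_ge0.
have /and3P[_ _ /eqP sum_la] := la_n.
(* As [n] is positive the diagram has a box, so the side of the square is a successor, the form
   required by ['I_m.+1]. *)
have hook_gt0 : (0 < max_hook la)%N.
  by case: (box_lt_max_hook (Ordinal n_gt0) la_n) => /(leq_ltn_trans (leq0n _)).
have hookE := prednK hook_gt0; set m := (max_hook la).-1 in hookE.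
pose r (k : 'I_n) : 'I_m.+1 := inord (reshape_index la k).
pose c (k : 'I_n) : 'I_m.+1 := inord (reshape_offset la k).
have rE k : r k = reshape_index la k :> nat.
  by rewrite inordK // hookE; case: (box_lt_max_hook k la_n).
have cE k : c k = reshape_offset la k :> nat.
  by rewrite inordK // hookE; case: (box_lt_max_hook k la_n).
have rc_inj x y : r x = r y -> c x = c y -> x = y.
  by move=> eq_r eq_c; apply: (@box_inj n la); rewrite -?rE -?cE ?eq_r ?eq_c.
rewrite (specht_ncharE R s sum_la rE cE) normc_def /= expr0n addr0 sqrtr_sqr lecR.
have := box_char_le R rc_inj s1; set k := #|moved s| => le_box.
have le_lk : (tperm_length s <= k)%N.
  by have := tperm_length_cycles s; rewrite -/k; lia.
have le_kl : (k <= (tperm_length s).*2)%N := card_moved_le s.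
have k_gt0 : (0 < k)%N.
  by have [x sx] := perm_neq1P s1; rewrite card_gt0; apply/set0Pn; exists x; rewrite inE.
apply: (@char_estimate _ C _ n k _ m.+1) => //.
- by rewrite le_lk andbT; lia.
- by rewrite -[n in (_ <= n)%N]card_ord max_card.
- by rewrite hookE.
rewrite real_normK ?num_real // expr_div_n mulrAC ler_pdivrMr ?exprn_gt0 ?ltr0n ?fact_gt0 //.
by rewrite natrM [n`!%:R ^+ 2]expr2 !mulrA ler_pM2r ?ltr0n ?fact_gt0.
Qed.
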